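(* Consider the network control setting, the local-information problem $(\mathrm{L}_b)$ and the partially-nested-information problem $(\mathrm{PN})$ described in the context. Problem $(\mathrm{L}_b)$ is a conservative approximation of Problem $(\mathrm{PN})$ in the following sense: every feasible solution of $(\mathrm{L}_b)$ is feasible in $(\mathrm{PN})$, and the optimal value of $(\mathrm L_b)$ is equal to or larger than the optimal value of $(\mathrm{PN})$.
   Context: **Network.** $\mathcal M=\{1,\dots,M\}$ is a set of agents, $\mathcal T=\{1,\dots,T\}$, $\mathcal T_+=\mathcal T\cup\{T+1\}$. A directed graph on $\mathcal M$ is given; an arc from $j$ to $i$ means the states of agent $j$ affect the dynamics of agent $i$. $\mathcal N_i\subset\mathcal M$ is the set of $j$ having an arc to $i$ (neighbors of $i$). Agent $j$ is a precedent to agent $i$ if the input of agent $j$ at a time $t'$ can affect the local information available to agent $i$ at some future time $t>t'$. $\overline{\mathcal N}_i\subseteq\mathcal M$ is the set that includes agent $i$ and all its precedent agents. **Notation.** For vectors $v_{i,t}$: $\boldsymbol v_{\mathcal A,t}=[v_{j,t}]_{j\in\mathcal A}$ for $\mathcal A\subseteq\mathcal M$; $\boldsymbol v_i^t=[v_{i,1},\dots,v_{i,t}]$ is the history up to $t$ (empty for $t=0$); $\boldsymbol v_{\mathcal A}^t=[\boldsymbol v_j^t]_{j\in\mathcal A}$; $\boldsymbol v_i$ is the concatenation over the whole horizon. **Dynamics.** Agent $i$ has states $x_{i,t}\in\mathbb R^{n_{x,i}}$ ($t\in\mathcal T_+$), inputs $u_{i,t}\in\mathbb R^{n_{u,i}}$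 and exogenous uncertainties $\xi_{i,t}\in\mathbb R^{n_{\xi,i}}$ ($t\in\mathcal T$), with $x_{i,1}$ known. The matrices $A_{i,t},B_{i,t},D_{i,t},E_{i,t}$ are known and of full column rank. The notation $\boldsymbol x_i=f_i(\boldsymbol\zeta_{\mathcal N_i},\boldsymbol u_i,\boldsymbol\xi_i)$ means $$x_{i,t+1}=A_{i,t}x_{i,t}+B_{i,t}\boldsymbol\zeta_{\mathcal N_i,t}+D_{i,t}u_{i,t}+E_{i,t}\xi_{i,t},\qquad t\in\mathcal T,$$ where $\boldsymbol x_i=[x_{i,t}]_{t\in\mathcal T_+}\in\mathbb R^{N_{x,i}}$, $N_{x,i}=(T+1)n_{x,i}$, $\boldsymbol u_i=[u_{i,t}]_{t\in\mathcal T}$, $\boldsymbol\xi_i=[\xi_{i,t}]_{t\in\mathcal T}$. **Constraints and objective.** $\mathcal O_i=\{(\boldsymbol x_i,\boldsymbol u_i): H_{x,i}\boldsymbol x_i+H_{u,i}\boldsymbol u_i\le h_i\}$ and $J_i(\boldsymbol x_i,\boldsymbol u_i)=\sum_{t=1}^T(\|Q_ix_{i,t}\|_q+\|R_iu_{i,t}\|_q)$ with $q\in\{1,\infty\}$, for given $H_{x,i},H_{u,i},h_i,Q_i,R_i$. **Uncertainty.** $\boldsymbol\xi_i\in\Xi_i$, a nonempty, convex, compact polyhedron; the joint uncertainty set is $\prod_{i\in\mathcal M}\Xi_i$, and $\Xi_{\overline{\mathcal N}_i}=\prod_{j\in\overline{\mathcal N}_i}\Xi_j$. **State forecast sets.**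 The state forecast set of agent $j$ is a compact set $\mathcal X_j\subseteq\mathbb R^{N_{x,j}}$ that contains the possible evolution of its states, $\boldsymbol x_j\in\mathcal X_j$; its shape is a decision. It is required that $\mathcal X_j\in\mathcal F(\mathcal S_j)$, where $\mathcal S_j\subseteq\mathbb R^{N_{x,j}}$ and $\mathcal F(\mathcal S_j)$ denotes the field of sets generated by all the subsets of the power set of $\mathcal S_j$. Write $\mathcal X_{\mathcal N_i}=\prod_{j\in\mathcal N_i}\mathcal X_j$. The vector $\boldsymbol\zeta_j=[\zeta_{j,t}]_{t\in\mathcal T_+}\in\mathcal X_j$, $\zeta_{j,t}\in\mathbb R^{n_{x,j}}$, is the belief about the states of agent $j$; when local policies are implemented, the belief $\boldsymbol\zeta_{\mathcal N_i}^t$ is substituted by the realized neighbor states $\boldsymbol x_{\mathcal N_i}^t$. **Problem (PN).** The decision variables are, for each $i\in\mathcal M$, a strictly causal partially nested uncertainty feedback policy $\boldsymbol\Phi_i(\boldsymbol\xi_{\overline{\mathcal N}_i})=[\Phi_{i,t}(\boldsymbol\xi_{\overline{\mathcal N}_i}^{t-1})]_{t\in\mathcal T}$, where $\Phi_{i,t}$ has values in $\mathbb R^{n_{u,i}}$. Minimize $$\sum_{i=1}^M\max_{\boldsymbol\xi_{\overline{\mathcal N}_i}\in\Xi_{\overline{\mathcal N}_i}}J_i(\boldsymbol x_i,\boldsymbol u_i)$$ subject to, for all $i\in\mathcal M$ and all $\boldsymbol\xi_{\overline{\mathcal N}_i}\in\Xi_{\overline{\mathcal N}_i}$: $\boldsymbol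 u_i=\boldsymbol\Phi_i(\boldsymbol\xi_{\overline{\mathcal N}_i})$, $\boldsymbol x_i=f_i(\boldsymbol x_{\mathcal N_i},\boldsymbol u_i,\boldsymbol\xi_i)$ (with the actual neighbor states $\boldsymbol x_{\mathcal N_i}$), $(\boldsymbol x_i,\boldsymbol u_i)\in\mathcal O_i$. **Problem ($\mathrm L_b$).** The decision variables are, for each $i\in\mathcal M$, the state forecast set $\mathcal X_i$ and an uncertainty feedback policy $\boldsymbol\Psi_i(\boldsymbol\xi_i,\boldsymbol\zeta_{\mathcal N_i})=[\Psi_{i,t}(\boldsymbol\xi_i^{t-1},\boldsymbol\zeta_{\mathcal N_i}^t)]_{t\in\mathcal T}$, where $\Psi_{i,t}$ has values in $\mathbb R^{n_{u,i}}$. Minimize $$\sum_{i=1}^M\max_{\boldsymbol\xi_i\in\Xi_i,\ \boldsymbol\zeta_{\mathcal N_i}\in\mathcal X_{\mathcal N_i}}J_i(\boldsymbol x_i,\boldsymbol u_i)$$ subject to, for all $i\in\mathcal M$, all $\boldsymbol\zeta_{\mathcal N_i}\in\mathcal X_{\mathcal N_i}$ and all $\boldsymbol\xi_i\in\Xi_i$: $\boldsymbol u_i=\boldsymbol\Psi_i(\boldsymbol\xi_i,\boldsymbol\zeta_{\mathcal N_i})$, $\boldsymbol x_i=f_i(\boldsymbol\zeta_{\mathcal N_i},\boldsymbol u_i,\boldsymbol\xi_i)$, $(\boldsymbol x_i,\boldsymbol u_i)\in\mathcal O_i$, $\boldsymbol x_i\in\mathcal X_i$, $\mathcal X_i\in\mathcal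 F(\mathcal S_i)$. *)

(* Defs.v *)
From HB Require Import structures.
From mathcomp Require Export all_boot all_order all_algebra.
From mathcomp Require Export all_classical all_reals all_analysis.

Set Implicit Arguments.
Unset Strict Implicit.
Unset Printing Implicit Defensive.

Export Order.TTheory GRing.Theory Num.Theory.
Export numFieldNormedType.Exports.

Local Open Scope classical_set_scope.
Local Open Scope ring_scope.

(* A signal over k time steps with values in R^n is a k x n matrix whose rows
   are its values; indices are 0-based, so index t : 'I_T is time t + 1.
   R^(k n), with the values stacked one after the other, is reached by [stack],
   which is a linear isomorphism. *)
Definition at_time (R : realType) (k n : nat) (v : 'M[R]_(k, n)) (t : 'I_k)
  : 'cV[R]_n := (row t v)^T.

Definition stack (R : realType) (k n : nat) (v : 'M[R]_(k, n))
  : 'cV[R]_(k * n) := (mxvec v)^T.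

Definition hist (R : realType) (l k n : nat) (lk : (l <= k)%N)
  (v : 'M[R]_(k, n)) : 'M[R]_(l, n) := rowsub (widen_ord lk) v.

Definition vec_le (R : realType) (n : nat) (a b : 'cV[R]_n) : Prop :=
  forall k, a k 0 <= b k 0.

Inductive norm_index := q_one | q_infty.

(* The library norm of a matrix is the maximum of the absolute values of its
   entries. *)
Definition qnorm (R : realType) (q : norm_index) (n : nat) (v : 'cV[R]_n) : R :=
  match q with
  | q_one => \sum_k `|v k 0|
  | q_infty => `|v|
  end.

(* Polyhedra are finite intersections of closed half-spaces. *)
Definition polyhedron (R : realType) (k n : nat) (P : set 'M[R]_(k, n)) : Prop :=
  exists (m : nat) (G : 'M[R]_(m, k * n)) (g : 'cV[R]_m),
    P = [set v | vec_le (G *m stack v) g].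

Definition field_of_sets (U : Type) (S : set U) (F : set_system U) : Prop :=
  [/\ F `<=` [set A | A `<=` S], F S, forall A, F A -> F (S `\` A)
    & setU_closed F].

(* The field of sets over S generated by all the subsets of the power set of S,
   i.e. by all the members of these subsets. *)
Definition generated_field (U : Type) (S : set U) : set_system U :=
  smallest (field_of_sets S)
    [set A | exists2 C : set_system U, C `<=` [set B | B `<=` S] & C A].

Record net_shape := NetShape {
  nagents : nat;
  horizon : nat;
  arc : rel 'I_nagents;  (* arc j i : the states of j affect the dynamics of i *)
  nx : 'I_nagents -> nat;
  nu : 'I_nagents -> nat;
  nxi : 'I_nagents -> nat }.

Notation agent G := 'I_(nagents G).
Notation state_traj R G i := 'M[R]_((horizon G).+1, nx (n := G) i).
Notation input_traj R G i := 'M[R]_(horizon G, nu (n := G) i).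
Notation noise_traj R G i := 'M[R]_(horizon G, nxi (n := G) i).

Definition neighbors (G : net_shape) (i : agent G) : {set agent G} :=
  [set j | arc j i].

(* affected j t' k s : the input of j at time t' can affect the state of k at
   time s. *)
Inductive affected (G : net_shape) (j : agent G) (t' : nat)
  : agent G -> nat -> Prop :=
| affected_input : affected j t' j t'.+1
| affected_self k s : affected j t' k s -> affected j t' k s.+1
| affected_arc k l s :
    affected j t' k s -> k \in neighbors l -> affected j t' l s.+1.

(* The local information of i at time t is its own past noise, which is
   exogenous, and the states of its neighbors up to time t.  Precedence is a
   property of the network and is not truncated at the horizon; hence
   precedents k is contained in precedents i for every neighbor k of i. *)
Definition precedent (G : net_shape) (j i : agent G) : Prop :=
  exists t' t : nat, (t' < t)%N /\
    exists k s, [/\ k \in neighbors i, (s <= t)%N & affected j t' k s].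

Definition precedents (G : net_shape) (i : agent G) : {set agent G} :=
  [set j | (j == i) || `[< precedent j i >]].

Definition restrict (G : net_shape) (V : agent G -> Type) (A : {set agent G})
  (v : forall j, V j) (j : {j | j \in A}) : V (val j) := v (val j).
Arguments restrict {G V} A v j.

Definition nbr_dim (G : net_shape) (i : agent G) : nat :=
  (\sum_(k < #|{: {j | j \in neighbors i}}|) nx (val (enum_val k)))%N.

Definition nbr_states (R : realType) (G : net_shape) (i : agent G)
  (z : forall j : {j | j \in neighbors i}, state_traj R G (val j))
  (t : 'I_(horizon G).+1) : 'cV[R]_(nbr_dim i) :=
  \mxcol_(k < #|{: {j | j \in neighbors i}}|) at_time (z (enum_val k)) t.

Record network (R : realType) (G : net_shape) := Network {
  A_ : forall i : agent G, 'I_(horizon G) -> 'M[R]_(nx i);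
  B_ : forall i : agent G, 'I_(horizon G) -> 'M[R]_(nx i, nbr_dim i);
  D_ : forall i : agent G, 'I_(horizon G) -> 'M[R]_(nx i, nu i);
  E_ : forall i : agent G, 'I_(horizon G) -> 'M[R]_(nx i, nxi i);
  x_init : forall i : agent G, 'cV[R]_(nx i);
  ncons : agent G -> nat;
  H_x : forall i : agent G, 'M[R]_(ncons i, (horizon G).+1 * nx i);
  H_u : forall i : agent G, 'M[R]_(ncons i, horizon G * nu i);
  h_ : forall i : agent G, 'cV[R]_(ncons i);
  q_ : norm_index;
  nQ : agent G -> nat;
  nR : agent G -> nat;
  Q_ : forall i : agent G, 'M[R]_(nQ i, nx i);
  R_ : forall i : agent G, 'M[R]_(nR i, nu i);
  Xi : forall i : agent G, set (noise_traj R G i);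
  S_ : forall i : agent G, set (state_traj R G i) }.

Arguments Xi {R G} n i.
Arguments S_ {R G} n i.

(* [row_full] says that the rank equals the number of columns, i.e. that the
   matrix has full column rank. *)
Definition full_column_rank (R : realType) (G : net_shape) (N : network R G)
  : Prop :=
  forall (i : agent G) (t : 'I_(horizon G)),
    [/\ row_full (A_ N i t), row_full (B_ N i t), row_full (D_ N i t)
      & row_full (E_ N i t)].

Definition uncertainty_polytopes (R : realType) (G : net_shape)
  (N : network R G) : Prop :=
  forall i : agent G,
    [/\ Xi N i !=set0, convex_set (Xi N i), compact (Xi N i)
      & polyhedron (Xi N i)].

(* dynamics N z u xi x is the equation x = f_i(z, u, xi); it has exactly one
   solution x, obtained by forward recursion. *)
Definition dynamics (R : realType) (G : net_shape) (N : network R G)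
  (i : agent G)
  (z : forall j : {j | j \in neighbors i}, state_traj R G (val j))
  (u : input_traj R G i) (xi : noise_traj R G i) (x : state_traj R G i)
  : Prop :=
  at_time x ord0 = x_init N i /\
  forall t : 'I_(horizon G),
    at_time x (lift ord0 t) =
      A_ N i t *m at_time x (widen_ord (leqnSn _) t)
      + B_ N i t *m nbr_states z (widen_ord (leqnSn _) t)
      + D_ N i t *m at_time u t
      + E_ N i t *m at_time xi t.

Definition operational (R : realType) (G : net_shape) (N : network R G)
  (i : agent G) (x : state_traj R G i) (u : input_traj R G i) : Prop :=
  vec_le (H_x N i *m stack x + H_u N i *m stack u) (h_ N i).

Definition cost (R : realType) (G : net_shape) (N : network R G)
  (i : agent G) (x : state_traj R G i) (u : input_traj R G i) : R :=
  \sum_(t < horizon G)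
    (qnorm (q_ N) (Q_ N i *m at_time x (widen_ord (leqnSn _) t))
     + qnorm (q_ N) (R_ N i *m at_time u t)).

(* Noise up to the previous time and states up to the current one, as seen
   at time index t. *)
Definition noise_past (R : realType) (G : net_shape) (i : agent G)
  (t : 'I_(horizon G)) (xi : noise_traj R G i) : 'M[R]_(t, nxi i) :=
  hist (ltnW (ltn_ord t)) xi.

Definition state_past (R : realType) (G : net_shape) (i : agent G)
  (t : 'I_(horizon G)) (x : state_traj R G i) : 'M[R]_(t.+1, nx i) :=
  hist (leqW (ltn_ord t)) x.

Definition pn_policy (R : realType) (G : net_shape) : Type :=
  forall (i : agent G) (t : 'I_(horizon G)),
    (forall j : {j | j \in precedents i}, 'M[R]_(t, nxi (val j))) ->
    'cV[R]_(nu i).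

Definition pn_input (R : realType) (G : net_shape) (Phi : pn_policy R G)
  (i : agent G)
  (xi : forall j : {j | j \in precedents i}, noise_traj R G (val j))
  (u : input_traj R G i) : Prop :=
  forall t, at_time u t = Phi i t (fun j => noise_past t (xi j)).

(* For every xi there is exactly one such pair (x, u). *)
Definition pn_closed_loop (R : realType) (G : net_shape) (N : network R G)
  (Phi : pn_policy R G) (xi : forall j : agent G, noise_traj R G j)
  (x : forall j : agent G, state_traj R G j)
  (u : forall j : agent G, input_traj R G j) : Prop :=
  forall i : agent G,
    pn_input Phi (restrict (precedents i) xi) (u i) /\
    dynamics N (restrict (neighbors i) x) (u i) (xi i) (x i).

(* The components of xi outside precedents i are left free: x i and u i do not
   depend on them, so that xi effectively ranges over the product of the
   uncertainty sets of the members of precedents i. *)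
Definition precedent_noise (R : realType) (G : net_shape) (N : network R G)
  (i : agent G) (xi : forall j : agent G, noise_traj R G j) : Prop :=
  forall j, j \in precedents i -> Xi N j (xi j).

Definition pn_feasible (R : realType) (G : net_shape) (N : network R G)
  (Phi : pn_policy R G) : Prop :=
  forall (i : agent G) xi x u,
    precedent_noise N i xi -> pn_closed_loop N Phi xi x u ->
    operational N (x i) (u i).

(* Worst cases are suprema and optimal values are infima in the extended reals:
   policies are arbitrary functions, so neither need be attained, and the
   optimal value of an infeasible problem is +oo. *)
Definition pn_cost (R : realType) (G : net_shape) (N : network R G)
  (Phi : pn_policy R G) : \bar R :=
  (\sum_(i < nagents G)
     ereal_sup [set c | exists xi x u,
       [/\ precedent_noise N i xi, pn_closed_loop N Phi xi x u
         & c = (cost N (x i) (u i))%:E]])%E.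

Definition pn_value (R : realType) (G : net_shape) (N : network R G)
  : \bar R :=
  ereal_inf (pn_cost N @` [set Phi | pn_feasible N Phi]).

Definition local_policy (R : realType) (G : net_shape) : Type :=
  forall (i : agent G) (t : 'I_(horizon G)),
    'M[R]_(t, nxi i) ->
    (forall j : {j | j \in neighbors i}, 'M[R]_(t.+1, nx (val j))) ->
    'cV[R]_(nu i).

Record local_solution (R : realType) (G : net_shape) := LocalSolution {
  forecast : forall i : agent G, set (state_traj R G i);
  policy : local_policy R G }.

Arguments forecast {R G} l i.

Definition local_input (R : realType) (G : net_shape) (Psi : local_policy R G)
  (i : agent G) (xi : noise_traj R G i)
  (z : forall j : {j | j \in neighbors i}, state_traj R G (val j))
  (u : input_traj R G i) : Prop :=
  forall t, at_time u t =
    Psi i t (noise_past t xi) (fun j => state_past t (z j)).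

Definition local_scenario (R : realType) (G : net_shape) (N : network R G)
  (s : local_solution R G) (i : agent G)
  (z : forall j : {j | j \in neighbors i}, state_traj R G (val j))
  (xi : noise_traj R G i) (x : state_traj R G i) (u : input_traj R G i)
  : Prop :=
  [/\ forall j, forecast s (val j) (z j), Xi N i xi,
      local_input (policy s) xi z u & dynamics N z u xi x].

(* A forecast set contains the possible evolution of the states, hence is
   nonempty; without this, empty sets along a directed cycle would satisfy all
   the other constraints vacuously. *)
Definition local_feasible (R : realType) (G : net_shape) (N : network R G)
  (s : local_solution R G) : Prop :=
  forall i : agent G,
    [/\ forecast s i !=set0, compact (forecast s i),
        generated_field (S_ N i) (forecast s i)
      & forall z xi x u, local_scenario N s z xi x u ->
          operational N x u /\ forecast s i x].

Definition local_cost (R : realType) (G : net_shape) (N : network R G)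
  (s : local_solution R G) : \bar R :=
  (\sum_(i < nagents G)
     ereal_sup [set c | exists z xi x u,
       @local_scenario R G N s i z xi x u /\ c = (cost N x u)%:E])%E.

Definition local_value (R : realType) (G : net_shape) (N : network R G)
  : \bar R :=
  ereal_inf (local_cost N @` [set s | local_feasible N s]).

(* Beliefs are replaced by the realized states of the neighbors. *)
Definition local_closed_loop (R : realType) (G : net_shape) (N : network R G)
  (Psi : local_policy R G) (xi : forall j : agent G, noise_traj R G j)
  (x : forall j : agent G, state_traj R G j)
  (u : forall j : agent G, input_traj R G j) : Prop :=
  forall i : agent G,
    local_input Psi (xi i) (restrict (neighbors i) x) (u i) /\
    dynamics N (restrict (neighbors i) x) (u i) (xi i) (x i).

(* Phi is Psi written as a feedback of the noise; at most one Phi satisfies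
   this, as every noise history extends to the whole horizon and network. *)
Definition implements (R : realType) (G : net_shape) (N : network R G)
  (Psi : local_policy R G) (Phi : pn_policy R G) : Prop :=
  forall xi x u, local_closed_loop N Psi xi x u ->
    forall i : agent G, pn_input Phi (restrict (precedents i) xi) (u i).

(* Main.v *)
(** An input at time [t] uses noise before [t] and neighbor states up to [t],
    and the states up to [t] only use noise before [t] of the precedents; so
    the closed loop of local policies exists, is unique and is a partially
    nested feedback of the noise.  Its states lie in the forecast sets even if
    the graph has cycles, by induction on time: if the realized states agree
    up to [t] with some member of each forecast set, then the response to
    these members, used as beliefs, lies in the forecast set and agrees with
    the realized states up to [t + 1].  Hence every partially nested scenario
    is a local scenario with the realized neighbor states as beliefs, which
    gives both feasibility and the comparison of the worst cases. *)

Require Import Defs.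
From mathcomp Require Import all_boot all_order all_algebra.
From mathcomp Require Import all_classical all_reals all_analysis.

Set Implicit Arguments.
Unset Strict Implicit.
Unset Printing Implicit Defensive.

Local Open Scope classical_set_scope.
Local Open Scope ring_scope.

(** [m] need not be at most [k], so states and inputs, whose numbers of rows differ by one, can
    share a bound. *)
Definition agree (R : realType) (m k n : nat) (v w : 'M[R]_(k, n)) : Prop :=
  forall t : 'I_k, (t < m)%N -> at_time v t = at_time w t.

Lemma agreeW (R : realType) (m m' k n : nat) (v w : 'M[R]_(k, n)) :
  (m <= m')%N -> agree m' v w -> agree m v w.
Proof. by move=> le_mm' vw t t_m; apply: vw; apply: leq_trans t_m le_mm'. Qed.

Lemma agree_sym (R : realType) (m k n : nat) (v w : 'M[R]_(k, n)) :
  agree m v w -> agree m w v.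
Proof. by move=> vw t t_m; rewrite vw. Qed.

Lemma at_time_inj (R : realType) (k n : nat) (v w : 'M[R]_(k, n)) :
  at_time v =1 at_time w -> v = w.
Proof. by move=> vw; apply/row_matrixP => t; apply: trmx_inj; apply: vw. Qed.

Lemma agree_eq (R : realType) (k n : nat) (v w : 'M[R]_(k, n)) :
  agree k v w -> v = w.
Proof. by move=> vw; apply: at_time_inj => t; apply: vw. Qed.

Lemma agree_hist (R : realType) (l k n : nat) (lk : (l <= k)%N)
  (v w : 'M[R]_(k, n)) : agree l v w <-> hist lk v = hist lk w.
Proof.
split=> [vw|/row_matrixP vw t t_l].
  apply/row_matrixP => t; rewrite !row_rowsub; apply: trmx_inj.
  exact: (vw (widen_ord lk t) (ltn_ord t)).
have := vw (Ordinal t_l); rewrite !row_rowsub /at_time.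
by rewrite (_ : widen_ord lk _ = t) => [->|]; last exact: val_inj.
Qed.

Lemma at_time_ex (R : realType) (k n : nat) (f : 'I_k -> 'cV[R]_n) :
  exists v : 'M[R]_(k, n), at_time v =1 f.
Proof.
by exists (\matrix_t (f t)^T) => t; rewrite /at_time rowK trmxK.
Qed.

(** Prefixing a chain of influence with the arc from [k] to [j] delays its effect by one step. *)
Lemma affected_neighbor (G : net_shape) (j k l : agent G) (t s : nat) :
  k \in neighbors j -> affected j t l s -> affected k t l s.+1.
Proof.
move=> kj; elim=> [|l' s' _ IH|l1 l2 s' _ IH l12].
- by apply: affected_arc kj; apply: affected_input.
- exact: affected_self.
- exact: affected_arc l12.
Qed.

Definition neighbor_closed (G : net_shape) (P : {set agent G}) : Prop :=
  forall j k, j \in P -> k \in neighbors j -> k \in P.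

(** The added delay only moves [t] to [t.+1]. Causality arguments can thus run on [precedents i]
    alone. *)
Lemma precedents_closed (G : net_shape) (i : agent G) :
  neighbor_closed (precedents i).
Proof.
suff H j k : j = i \/ precedent j i -> k \in neighbors j -> precedent k i.
  move=> j k; rewrite ![_ \in precedents _]finset.in_set => ji kj.
  apply/orP; right; apply/asboolP; apply: H kj.
  by case/predU1P: ji => [|/asboolP]; [left | right].
case=> [->|[t' [t [lt_t't [l [s [li st jl]]]]]]] kj.
  by exists 0%N, 1%N; split=> //; exists k, 1%N; split=> //;
    apply: affected_input.
exists t', t.+1; split; first exact: ltnW.
by exists l, s.+1; split=> //; apply: affected_neighbor jl.
Qed.

Section Network.
Variables (R : realType) (G : net_shape) (N : network R G).

(** One row is gained because the state equation only reads data one step earlier, from a fixed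
    initial state. *)
Lemma dynamics_agree (m : nat) (i : agent G) z z' (u u' : input_traj R G i)
  (xi xi' : noise_traj R G i) (x x' : state_traj R G i) :
  dynamics N z u xi x -> dynamics N z' u' xi' x' ->
  (forall j, agree m (z j) (z' j)) -> agree m u u' -> agree m xi xi' ->
  agree m.+1 x x'.
Proof.
move=> [x0 xS] [x'0 x'S] zz uu xx [t lt_t] /=.
elim: t lt_t => [|t IH] lt_t t_m.
  have -> : Ordinal lt_t = ord0 by apply: val_inj.
  by rewrite x0 x'0.
have t_T : (t < horizon G)%N by rewrite -ltnS.
have -> : Ordinal lt_t = lift ord0 (Ordinal t_T) by apply: val_inj.
rewrite xS x'S uu // xx //.
rewrite (_ : widen_ord _ _ = Ordinal (ltnW lt_t)); last exact: val_inj.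
rewrite IH; last exact: ltnW.
congr (_ + _ *m _ + _ + _); rewrite /nbr_states.
by apply: eq_mxcol => k; rewrite zz.
Qed.

(** The two bounds differ because an input sees current beliefs but only past noise. *)
Lemma local_input_agree (Psi : local_policy R G) (m : nat) (i : agent G) z z'
  (u u' : input_traj R G i) (xi xi' : noise_traj R G i) :
  local_input Psi xi z u -> local_input Psi xi' z' u' ->
  (forall j, agree m.+1 (z j) (z' j)) -> agree m xi xi' -> agree m.+1 u u'.
Proof.
move=> uE u'E zz xx t t_m; rewrite uE u'E; congr (Psi i t _ _).
  by apply/agree_hist; apply: agreeW xx.
by apply: functional_extensionality_dep => j; apply/agree_hist;
  apply: agreeW (zz j).
Qed.

Lemma dynamics_ex (i : agent G) z (u : input_traj R G i)
  (xi : noise_traj R G i) : exists x, dynamics N z u xi x.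
Proof.
(* The default 0 only enters beyond the last row. *)
pose f := nat_rect (fun=> 'cV[R]_(nx i)) (x_init N i) (fun t xt =>
  if insub t is Some t' then
    A_ N i t' *m xt + B_ N i t' *m nbr_states z (widen_ord (leqnSn _) t')
    + D_ N i t' *m at_time u t' + E_ N i t' *m at_time xi t'
  else 0).
have [x xE] := at_time_ex (fun t : 'I_(horizon G).+1 => f t).
exists x; split=> [|t]; first by rewrite xE.
by rewrite !xE lift0 /= insubT //= => ?; rewrite (_ : Sub _ _ = t) //;
  apply: val_inj.
Qed.

Lemma local_response_ex (Psi : local_policy R G) (i : agent G) z
  (xi : noise_traj R G i) :
  exists x u, local_input Psi xi z u /\ dynamics N z u xi x.
Proof.
have [u uE] := at_time_ex (fun t =>
  Psi i t (noise_past t xi) (fun j => state_past t (z j))).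
by have [x xE] := dynamics_ex z u xi; exists x, u.
Qed.

(* Picard iteration: the m-th iterate is correct on the first m rows. *)
Lemma local_closed_loop_ex (Psi : local_policy R G)
  (xi : forall j : agent G, noise_traj R G j) :
  exists x u, local_closed_loop N Psi xi x u.
Proof.
have iterate (y : forall j : agent G, state_traj R G j) : exists x u,
    forall i, local_input Psi (xi i) (Defs.restrict (neighbors i) y) (u i) /\
      dynamics N (Defs.restrict (neighbors i) y) (u i) (xi i) (x i).
  have r i := cid (local_response_ex Psi (Defs.restrict (neighbors i) y) (xi i)).
  exists (fun i => sval (r i)), (fun i => sval (cid (svalP (r i)))) => i.
  exact: (svalP (cid (svalP (r i)))).
have approx m : exists y x u, (forall j, agree m (y j) (x j)) /\
    forall i, local_input Psi (xi i) (Defs.restrict (neighbors i) y) (u i) /\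
      dynamics N (Defs.restrict (neighbors i) y) (u i) (xi i) (x i).
  elim: m => [|m [y [x [u [yx xu]]]]].
    have [x [u xu]] := iterate (fun=> 0).
    by exists (fun=> 0), x, u; split.
  have [x' [u' xu']] := iterate x; exists x, x', u'; split=> // i.
  have [[ui di] [ui' di']] := (xu i, xu' i).
  apply: (dynamics_agree di di') => // [j|]; first exact: yx.
  case: m yx => // m yx.
  by apply: (local_input_agree ui ui') => // j; apply: yx.
(* With all rows correct, the beliefs [y] equal the response [x]: a fixed point. *)
have [y [x [u [yx xu]]]] := approx (horizon G).+1.
suff yE : y = x by exists x, u; rewrite yE in xu.
by apply: functional_extensionality_dep => j; apply: agree_eq.
Qed.

(** Closedness keeps all that members of [P] react to inside [P]. At each time the states are
    compared first, since inputs read current neighbor states. *)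
Lemma local_closed_loop_agree (Psi : local_policy R G) (P : {set agent G})
  (m : nat) xi xi' x x' u u' :
  neighbor_closed P ->
  local_closed_loop N Psi xi x u -> local_closed_loop N Psi xi' x' u' ->
  (forall j, j \in P -> agree m (xi j) (xi' j)) ->
  forall j, j \in P -> agree m.+1 (x j) (x' j) /\ agree m.+1 (u j) (u' j).
Proof.
move=> clP xu xu' xx.
have step l : (l <= m)%N ->
    (forall j, j \in P -> agree l (x j) (x' j) /\ agree l (u j) (u' j)) ->
    forall j, j \in P -> agree l.+1 (x j) (x' j) /\ agree l.+1 (u j) (u' j).
  move=> lm IH.
  have xxl j : j \in P -> agree l (xi j) (xi' j).
    by move=> /xx; apply: agreeW.
  have Hx j : j \in P -> agree l.+1 (x j) (x' j).
    move=> jP; apply: (dynamics_agree (xu j).2 (xu' j).2).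
    - by move=> [k kj] /=; apply: (IH k (clP _ _ jP kj)).1.
    - exact: (IH j jP).2.
    - exact: xxl.
  move=> j jP; split; first exact: Hx.
  apply: (local_input_agree (xu j).1 (xu' j).1); last exact: xxl.
  by move=> [k kj] /=; apply: Hx; apply: clP jP kj.
have : (m <= m)%N by [].
elim: {1 3 4}m => [|l IH] lm; first exact: step.
by apply: step => //; apply: IH; apply: ltnW.
Qed.

(** Inputs depend on the noise alone, so they are settled before the states. *)
Lemma pn_closed_loop_uniq (Phi : pn_policy R G) xi x u x' u' :
  pn_closed_loop N Phi xi x u -> pn_closed_loop N Phi xi x' u' ->
  x = x' /\ u = u'.
Proof.
move=> xu xu'.
have uE : u = u'.
  apply: functional_extensionality_dep => i; apply: at_time_inj => t.
  by rewrite (xu i).1 (xu' i).1.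
split=> //; rewrite -{}uE in xu' *.
suff H m i : agree m (x i) (x' i).
  by apply: functional_extensionality_dep => i; apply: agree_eq.
elim: m i => [|m IH] i //.
by apply: (dynamics_agree (xu i).2 (xu' i).2) => // -[k ki] /=; apply: IH.
Qed.

Lemma implements_ex (Psi : local_policy R G) :
  exists Phi : pn_policy R G, implements N Psi Phi.
Proof.
(* The candidate values [v] are the inputs of closed loops with noise history [h]; causality makes
   them coincide. *)
pose loop i (t : 'I_(horizon G))
    (h : forall j : {j | j \in precedents i}, 'M[R]_(t, nxi (val j))) v :=
  exists xi x u, [/\ local_closed_loop N Psi xi x u,
    (fun j => noise_past t (Defs.restrict (precedents i) xi j)) = h
    & v = at_time (u i) t].
exists (fun i t h => xget 0 (loop i t h)) => xi x u xu i t.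
case: xgetP => [v -> [xi' [x' [u' [xu' hE ->]]]]|none]; last first.
  (* The loop at hand is a witness, which rules out the default 0 of [xget]. *)
  by case: (none (at_time (u i) t)); exists xi, x, u.
have [] // := @local_closed_loop_agree Psi (precedents i) t xi xi' x x' u u'
  (@precedents_closed G i) xu xu' _ i.
- move=> j ji; apply: agree_sym; apply/(agree_hist (ltnW (ltn_ord t))).
  by have /= := f_equal (fun h => h (exist _ j ji)) hE.
- by rewrite !inE eqxx.
- by move=> _; apply.
Qed.

(** The local loop for the same noise exists and also solves the loop of [Phi], so uniqueness
    identifies the two. *)
Lemma implements_closed_loop (Psi : local_policy R G) (Phi : pn_policy R G)
  xi x u :
  implements N Psi Phi -> pn_closed_loop N Phi xi x u ->
  local_closed_loop N Psi xi x u.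
Proof.
move=> imp xu; have [x' [u' xu']] := local_closed_loop_ex Psi xi.
have [-> -> //] : x = x' /\ u = u'.
apply: pn_closed_loop_uniq xu _ => i.
by split; [apply: imp xu' i | case: (xu' i)].
Qed.

Lemma closed_loop_forecast (s : local_solution R G) (P : {set agent G})
  xi x u :
  local_feasible N s -> neighbor_closed P ->
  (forall j, j \in P -> Xi N j (xi j)) ->
  local_closed_loop N (policy s) xi x u ->
  forall j, j \in P -> forecast s j (x j).
Proof.
move=> feas clP xiP xu.
have prefix m j : j \in P -> exists2 z, forecast s j z & agree m z (x j).
  elim: m j => [|m IH] j jP.
    by have [[z zj] _ _ _] := feas j; exists z.
  (* The realized states are not yet known to be admissible beliefs; members [z] of the forecast
     sets with the same first [m] rows stand in for them. *)
  have r (k : {k | k \in neighbors j}) := cid2 (IH _ (clP _ _ jP (valP k))).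
  pose z k := s2val (r k).
  have zx k : agree m (z k) (Defs.restrict (neighbors j) x k) := s2valP' (r k).
  have zs k : forecast s (val k) (z k) := s2valP (r k).
  clearbody z; clear r IH.
  have [y [v [vE yE]]] := local_response_ex (policy s) z (xi j).
  have [_ _ _ /(_ z (xi j) y v)[|_ yj]] := feas j.
    by split=> //; apply: xiP.
  exists y => //; apply: (dynamics_agree yE (xu j).2) => //.
  (* [local_input_agree] only gives positive bounds; for bound 0 there is no input to compare. *)
  case: m zx => // m zx.
  by apply: (local_input_agree vE (xu j).1).
by move=> j /(prefix (horizon G).+1)[z zj /agree_eq <-].
Qed.

Lemma pn_local_scenario (s : local_solution R G) (Phi : pn_policy R G)
  (i : agent G) xi x u :
  local_feasible N s -> implements N (policy s) Phi ->
  precedent_noise N i xi -> pn_closed_loop N Phi xi x u ->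
  local_scenario N s (Defs.restrict (neighbors i) x) (xi i) (x i) (u i).
Proof.
move=> feas imp xiP /(implements_closed_loop imp) xu.
have ii : i \in precedents i by rewrite !inE eqxx.
split; [|exact: xiP|exact: (xu i).1|exact: (xu i).2].
move=> [k ki].
apply: (closed_loop_forecast feas (@precedents_closed G i) xiP xu).
exact: precedents_closed ii ki.
Qed.

End Network.

Theorem theorem3 (R : realType) (G : net_shape) (N : network R G)
  (hrank : full_column_rank N) (hXi : uncertainty_polytopes N) :
  (forall s : local_solution R G, local_feasible N s ->
     exists Phi : pn_policy R G,
       implements N (policy s) Phi /\ pn_feasible N Phi) /\
  (pn_value N <= local_value N)%E.
Proof.
have feasible s Phi : local_feasible N s -> implements N (policy s) Phi ->
    pn_feasible N Phi.
  move=> feas imp i xi x u xiP xu.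
  have [_ _ _ /(_ _ _ _ _ (pn_local_scenario feas imp xiP xu))[]//] := feas i.
split=> [s feas|].
  by have [Phi imp] := implements_ex N (policy s); exists Phi; split;
    [|apply: feasible imp].
apply/ereal_infP => _ [s feas <-].
have [Phi imp] := implements_ex N (policy s).
apply: (@le_trans _ _ (pn_cost N Phi)).
  by apply: ereal_inf_lbound; exists Phi => //; apply: feasible imp.
(* For each agent the partially nested costs are among the local ones, so the suprema compare term
   by term. *)
apply: lee_sum => i _; apply: ereal_sup_le => c [xi [x [u [xiP xu ->]]]].
exists (Defs.restrict (neighbors i) x), (xi i), (x i), (u i).
by split=> //; apply: pn_local_scenario xu.
Qed.
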